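(* Let $d\geq 3$. Let $\Delta$ be a strongly connected $(d-1)$-dimensional simplicial complex with a map $p:V(\Delta)\to\mathbb{R}^d$ such that for any two adjacent facets $F,F'$ of $\Delta$, the $d+1$ points $p(F\cup F')$ are affinely independent. Then $$\mathrm{Stress}^a_1(\Delta,p)=\sum_{G\in\Delta,\ \dim G=d-3}\mathrm{Stress}^a_1(\mathrm{st}(G),p).$$ In particular, $\mathrm{Stress}^a_1(\Delta,p)=\sum_{v\in V(\Delta)}\mathrm{Stress}^a_1(\mathrm{st}(v),p)$.
   Context: A pure $(d-1)$-dimensional complex has all facets of dimension $d-1$; two facets are adjacent if they share a $(d-2)$-face; the complex is strongly connected if any two facets are joined by a sequence of pairwise adjacent facets. Stresses: for $\Gamma$ on vertex set $V$ and $p:V\to\mathbb{R}^d$, let $\mathbb{R}[X]=\mathbb{R}[x_v:v\in V]$, $\theta_m=\sum_v p(v)_mx_v$ ($m=1,\dots,d$), $c=\sum_v x_v$, and $\partial_\ell=\sum_v\ell_v\partial/\partial x_v$ for $\ell=\sum_v\ell_vx_v$. A homogeneous degree-$k$ polynomial $\lambda$ is an affine $k$-stress on $(\Gamma,p)$ if every monomial with nonzero coefficient has support a face of $\Gamma$, $\partial_{\theta_m}\lambda=0$ for $m=1,\dots,d$, and $\partial_c\lambda=0$. $\mathrm{Stress}^a_k(\Gamma,p)$ is the space of these (for a subcomplex, $p$ restricted); thus $\mathrm{Stress}^a_1(\Gamma,p)$ consists of $\sum_va_vx_v$ with $(a_v)$ an affine dependence of the points $p(v)$ supported on vertices of $\Gamma$.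 The star is $\mathrm{st}(G)=\{\sigma\in\Delta:\sigma\cup G\in\Delta\}$. *)

(* Defs.v *)
From mathcomp Require Import all_boot all_order all_algebra.
From mathcomp Require Import reals.
From mathcomp Require Import mpoly.

Set Implicit Arguments.
Unset Strict Implicit.
Unset Printing Implicit Defensive.

Import GRing.Theory.
Local Open Scope ring_scope.

(* Complexes are finite sets of faces on a ground set 'I_n.  An element i of
   'I_n need not be a vertex, so that a complex and its subcomplexes live on
   the same ground set. *)
Section Complexes.

Variable n : nat.
Implicit Types (Delta : {set {set 'I_n}}) (F G s : {set 'I_n}).

Definition simplicial_complex Delta : Prop :=
  set0 \in Delta /\ forall s F, F \in Delta -> s \subset F -> s \in Delta.

Definition vertices Delta : {set 'I_n} := [set v | [set v] \in Delta].

(* Integer-valued: the empty face has dimension -1. *)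
Definition face_dim s : int := #|s|%:Z - 1.

Definition facet Delta F : bool := maxset (fun s => s \in Delta) F.

Definition pure Delta (e : int) : Prop := forall F, facet Delta F -> face_dim F = e.

Definition adjacent Delta (e : int) : rel {set 'I_n} := fun F F' =>
  [&& facet Delta F, facet Delta F', F != F' &
      [exists s in Delta, [&& s \subset F, s \subset F' & face_dim s == e - 1]]].

Definition strongly_connected Delta (e : int) : Prop :=
  pure Delta e /\
  forall F F', facet Delta F -> facet Delta F' ->
    connect (adjacent Delta e) F F'.

Definition star Delta G : {set {set 'I_n}} :=
  [set s in Delta | s :|: G \in Delta].

End Complexes.

(* Affine independence of the family (p v)_{v in S}; in particular p is then
   injective on S. *)
Definition affinely_independent (R : realType) (n d : nat)
    (p : 'I_n -> 'rV[R]_d) (S : {set 'I_n}) : Prop :=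
  forall a : 'I_n -> R,
    \sum_(v in S) a v = 0 -> \sum_(v in S) a v *: p v = 0 ->
    forall v, v \in S -> a v = 0.

Section Stresses.

Variables (R : realType) (n d : nat).
Implicit Types (Gamma : {set {set 'I_n}}) (p : 'I_n -> 'rV[R]_d).
Implicit Types (l q : {mpoly R[n]}).

Definition partial l q : {mpoly R[n]} := \sum_(v < n) l@_U_(v) *: q^`M(v).

(* The sums range over the vertices of Gamma only, so these are the forms
   attached to the restriction of p to the vertex set of Gamma. *)
Definition theta Gamma p (m : 'I_d) : {mpoly R[n]} :=
  \sum_(v in vertices Gamma) p v 0 m *: 'X_v.

Definition cform Gamma : {mpoly R[n]} := \sum_(v in vertices Gamma) 'X_v.

Definition msupport (m : 'X_{1..n}) : {set 'I_n} := [set v | m v != 0%N].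

(* A polynomial satisfying the support condition involves only variables
   indexed by vertices of Gamma, so stresses on subcomplexes are taken in the
   polynomial ring over the whole ground set. *)
Definition affine_stress (k : nat) Gamma p : {pred {mpoly R[n]}} := fun q =>
  [&& q \is k.-homog,
      all (fun m => msupport m \in Gamma) (msupp q),
      [forall m : 'I_d, partial (theta Gamma p m) q == 0] &
      partial (cform Gamma) q == 0].

End Stresses.

(* Membership in the sum of the subspaces (S i)_{i | P i}. *)
Definition in_sum (V : nmodType) (I : finType) (P : pred I)
    (S : I -> {pred V}) (x : V) : Prop :=
  exists2 f : I -> V, (forall i, P i -> f i \in S i) & x = \sum_(i | P i) f i.

(* Main.v *)
(* Work modulo the sum W of the stress spaces of the stars of the (d-3)-faces.
   Fix adjacent facets F, F'; the d+1 points of F :|: F' form an affine basis.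
   Three consecutive facets of a path share a (d-3)-face G, whose star contains
   all their vertices, so the vertices of the third facet are, modulo
   Stress(st G), combinations of those of the first two.  Following paths,
   every vertex is modulo W a combination of F :|: F', and a stress supported
   on F :|: F' vanishes by affine independence.  If there is only one facet,
   the star of any of its (d-3)-faces is the whole complex. *)

Require Import Defs.
From mathcomp Require Import all_boot all_order all_algebra.
From mathcomp Require Import reals.
From mathcomp Require Import mpoly.
From mathcomp Require Import zify.

Set Implicit Arguments.
Unset Strict Implicit.
Unset Printing Implicit Defensive.

Import GRing.Theory.
Local Open Scope ring_scope.

(** * Subspaces given as predicates, and sums of families of them *)

Section Submodules.

Variables (R : nzRingType) (V : lmodType R).

(** Stated for [Prop] predicates because [in_sum] is existential, not boolean. *)
Definition submodule (T : V -> Prop) : Prop :=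
  T 0 /\ forall a x y, T x -> T y -> T (a *: x + y).

Lemma submoduleD T x y : submodule T -> T x -> T y -> T (x + y).
Proof. by move=> [_ TZD] Tx Ty; rewrite -[x]scale1r; apply: TZD. Qed.

Lemma submodule_sum T (I : finType) (A : {pred I}) (c : I -> R) (F : I -> V) :
  submodule T -> (forall i, i \in A -> T (F i)) ->
  T (\sum_(i in A) c i *: F i).
Proof.
move=> [T0 TZD] TF; elim/big_rec: _ => // i x iA Tx.
by apply: TZD => //; apply: TF.
Qed.

Section InSum.

Variables (I : finType) (P : pred I) (S : I -> {pred V}).
Hypothesis subS : forall i, P i -> submodule (fun x => x \in S i).

Lemma in_sum_mem i x : P i -> x \in S i -> in_sum P S x.
Proof.
move=> Pi Sx; exists (fun j => if j == i then x else 0).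
  by move=> j Pj; case: eqP => [->|_] //; case: (subS Pj).
rewrite -big_mkcondr /= (big_pred1 i) // => j.
by rewrite andbC /=; case: (j =P i) => // ->; rewrite Pi.
Qed.

Lemma submodule_in_sum : submodule (in_sum P S).
Proof.
split; first by exists (fun=> 0); [move=> i /subS[] | rewrite big1].
move=> a _ _ [f Sf ->] [g Sg ->]; exists (fun i => a *: f i + g i).
  by move=> i Pi; case: (subS Pi) => _; apply; [apply: Sf | apply: Sg].
by rewrite big_split scaler_sumr.
Qed.

Lemma in_sum_sub (T : V -> Prop) x : submodule T ->
  (forall i y, P i -> y \in S i -> T y) -> in_sum P S x -> T x.
Proof.
move=> subT ST [f Sf ->]; elim/big_rec: _ => [|i y Pi Ty]; first by case: subT.
by apply: submoduleD => //; apply: ST (Sf i Pi).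
Qed.

End InSum.

(** Makes membership in [T] plus a span a linear condition, so that for a stress it need only be
    checked on the variables of the vertices. *)
Lemma submodule_mod_span (T : V -> Prop) (I : finType) (A : {pred I})
    (F : I -> V) : submodule T ->
  submodule (fun x => exists b, T (x - \sum_(i in A) b i *: F i)).
Proof.
move=> [T0 TZD]; split.
  by exists (fun=> 0); rewrite big1 ?subr0 // => i _; rewrite scale0r.
move=> a x y [b Tx] [c Ty]; exists (fun i => a * b i + c i).
have := TZD a _ _ Tx Ty.
under [in X in _ -> X]eq_bigr do rewrite scalerDl -scalerA.
by rewrite big_split -scaler_sumr /= scalerBr opprD addrACA.
Qed.

End Submodules.

(** * Degree-one stresses as affine dependences *)

Section LinearStresses.

Variables (R : realType) (n d : nat).
Implicit Types (a b : 'I_n -> R) (q : {mpoly R[n]}) (p : 'I_n -> 'rV[R]_d).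
Implicit Types (Gamma : {set {set 'I_n}}).

Lemma mcoeff_linear_form a w : (\sum_v a v *: 'X_v : {mpoly R[n]})@_U_(w) = a w.
Proof.
rewrite raddf_sum /= (bigD1 w) //= mcoeffZ mcoeffX eqxx mulr1.
rewrite big1 ?addr0 // => v vw.
by rewrite mcoeffZ mcoeffX eq_mnm1 (negbTE vw) mulr0.
Qed.

Lemma linear_formE q : q \is 1.-homog -> q = \sum_v q@_U_(v) *: 'X_v.
Proof.
move=> hq; apply/mpolyP => m.
have [|m1] := boolP (mdeg m == 1).
  by rewrite mdeg_eq1 => /existsP[w /eqP->]; rewrite mcoeff_linear_form.
rewrite (dhomog_nemf_coeff hq) // raddf_sum big1 //= => v _.
rewrite mcoeffZ mcoeffX; case: eqP => [e|]; last by rewrite mulr0.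
by rewrite -e mdeg1 in m1.
Qed.

Lemma partial_linear_form (l : {mpoly R[n]}) a :
  partial l (\sum_v a v *: 'X_v) = (\sum_v l@_U_(v) * a v)%:MP.
Proof.
have dE v : (\sum_w a w *: 'X_w : {mpoly R[n]})^`M(v) = (a v)%:MP.
  rewrite (raddf_sum (mderiv v)) (bigD1 v) //= big1 ?addr0 => [|w wv].
    rewrite mderivZ mderivX mnm1E eqxx scale1r -{1}[U_(v)%MM]add0m addmK mpolyX0.
    by rewrite -mul_mpolyC mulr1.
  by rewrite mderivZ mderivX mnm1E (negbTE wv) scale0r scaler0.
rewrite (raddf_sum (@mpolyC n R)) /=; apply: eq_bigr => v _.
by rewrite dE -mul_mpolyC mpolyCM.
Qed.

Lemma mcoeff_vertex_form Gamma b w :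
  (\sum_(v in vertices Gamma) b v *: 'X_v : {mpoly R[n]})@_U_(w) =
  if [set w] \in Gamma then b w else 0.
Proof.
rewrite -[RHS](mcoeff_linear_form (fun v => if [set v] \in Gamma then b v else 0)).
rewrite big_mkcond; congr _@__; apply: eq_bigr => v _.
by rewrite inE; case: ifP; rewrite ?scale0r.
Qed.

Definition affine_dependence Gamma p a : Prop :=
  [/\ forall v, [set v] \notin Gamma -> a v = 0,
      \sum_v a v = 0 & \sum_v a v *: p v = 0].

(** The derivatives of a linear form are constants, so the differential conditions become scalar
    equations in its coefficients. These vanish off the vertices of [Gamma], so sums over the
    vertices may be replaced by sums over the whole ground set. *)
Lemma affine_stress1P Gamma p q :
  q \in affine_stress 1 Gamma p <->
  exists2 a, affine_dependence Gamma p a & q = \sum_v a v *: 'X_v.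
Proof.
have thetaE a m : (forall v, [set v] \notin Gamma -> a v = 0) ->
    partial (theta Gamma p m) (\sum_v a v *: 'X_v)
    = ((\sum_v a v *: p v) 0 m)%:MP.
  move=> a0; rewrite partial_linear_form; congr _%:MP.
  rewrite summxE; apply: eq_bigr => v _; rewrite mcoeff_vertex_form mxE mulrC.
  by case: ifPn => // /a0->; rewrite !mul0r.
have cE a : (forall v, [set v] \notin Gamma -> a v = 0) ->
    partial (cform R Gamma) (\sum_v a v *: 'X_v) = (\sum_v a v)%:MP.
  move=> a0; rewrite partial_linear_form; congr _%:MP; apply: eq_bigr => v _.
  have -> : cform R Gamma = \sum_(w in vertices Gamma) (fun=> 1) w *: 'X_w.
    by apply: eq_bigr => w _; rewrite scale1r.
  rewrite mcoeff_vertex_form.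
  by case: ifPn => [_|/a0->]; rewrite ?mul1r ?mulr0.
have msupp1 v : msupport U_(v)%MM = [set v].
  by apply/setP => w; rewrite !inE mnm1E (eq_sym w); case: (v == w).
rewrite unfold_in; split=> [/and4P[hq /allP sq /forallP thq /eqP cq] | [a [a0 a1 ap] ->]].
  exists (fun v => q@_U_(v)); last exact: linear_formE.
  have a0 v : [set v] \notin Gamma -> q@_U_(v) = 0.
    by apply: contraNeq; rewrite -mcoeff_msupp => /sq; rewrite msupp1.
  rewrite (linear_formE hq) (cE _ a0) in cq.
  split=> //; first by apply/eqP; rewrite -(mpolyC_eq0 n) cq.
  apply/rowP => m; rewrite mxE; apply/eqP; rewrite -(mpolyC_eq0 n) -thetaE //.
  by rewrite -linear_formE.
apply/and4P; split.
- by apply: rpred_sum => v _; apply: rpredZ; rewrite dhomogX /= mdeg1.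
- apply/allP => m; have [/eqP|m1] := eqVneq (mdeg m) 1.
    rewrite mdeg_eq1 => /existsP[w /eqP->].
    rewrite mcoeff_msupp mcoeff_linear_form msupp1.
    by apply: contraNT => /a0->.
  rewrite mcoeff_msupp raddf_sum big1 ?eqxx // => v _; rewrite /= mcoeffZ mcoeffX.
  by case: eqP => [e|]; [rewrite -e mdeg1 in m1 | rewrite mulr0].
- by apply/forallP => m; rewrite thetaE // ap mxE mpolyC0.
- by rewrite cE // a1 mpolyC0.
Qed.

Lemma submodule_affine_stress1 Gamma p :
  submodule (fun q => q \in affine_stress 1 Gamma p).
Proof.
split.
  apply/affine_stress1P; exists (fun=> 0).
    by split=> //; rewrite big1 // => v _; rewrite scale0r.
  by rewrite big1 // => v _; rewrite scale0r.
move=> c _ _ /affine_stress1P[a [a0 a1 ap] ->] /affine_stress1P[b [b0 b1 bp] ->].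
apply/affine_stress1P; exists (fun v => c * a v + b v).
  split.
  - by move=> v vG; rewrite a0 // b0 // mulr0 addr0.
  - by rewrite big_split -mulr_sumr /= a1 b1 mulr0 addr0.
  - under eq_bigr do rewrite scalerDl -scalerA.
    by rewrite big_split -scaler_sumr /= ap bp scaler0 addr0.
under [RHS]eq_bigr do rewrite scalerDl -scalerA.
by rewrite big_split -scaler_sumr.
Qed.

(** In degree one only the vertex set of the complex matters. This serves in both directions: from a
    star into [Delta], and from [Delta] into a star that contains all its vertices. *)
Lemma affine_stress1_sub Gamma Gamma' p q :
  (forall v, [set v] \in Gamma -> [set v] \in Gamma') ->
  q \in affine_stress 1 Gamma p -> q \in affine_stress 1 Gamma' p.
Proof.
move=> sub /affine_stress1P[a [a0 a1 ap] ->]; apply/affine_stress1P; exists a => //.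
by split=> // v vG'; apply: a0; apply: contra vG'; apply: sub.
Qed.

(** Homogenize: affine independence says that the rows [(1, p v)] are linearly independent. There
    are [d.+1] of them in dimension [1 + d], so they span, and [(1, y)] is a combination of them. *)
Lemma affine_coordinates p (S : {set 'I_n}) (y : 'rV[R]_d) :
  affinely_independent p S -> #|S| = d.+1 ->
  exists2 c : 'I_n -> R, \sum_(v in S) c v = 1 & \sum_(v in S) c v *: p v = y.
Proof.
move=> indep cS.
(* [x0] only provides the default value of [enum_rank_in]. *)
have [x0 x0S] : exists x0, x0 \in S by apply/set0Pn; rewrite -card_gt0 cS.
pose P : 'M[R]_(#|S|, d) := \matrix_i p (enum_val i).
pose A : 'M[R]_(#|S|, 1 + d) := row_mx (const_mx 1) P.
pose c (u : 'rV[R]_#|S|) v := u 0 (enum_rank_in x0S v).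
have cE u i : c u (enum_val i) = u 0 i by rewrite /c enum_valK_in.
have mulA u :
    u *m A = row_mx (\sum_(v in S) c u v)%:M (\sum_(v in S) c u v *: p v).
  rewrite mul_mx_row; congr row_mx; rewrite [in RHS]big_enum_val /=.
    apply/matrixP => i j; rewrite !ord1 !mxE mulr1n.
    by apply: eq_bigr => k _; rewrite mxE mulr1 cE.
  by rewrite mulmx_sum_row; apply: eq_bigr => k _; rewrite cE rowK.
have fullA : row_full A.
  suff: row_free A by rewrite /row_free /row_full => /eqP->; rewrite cS.
  apply: inj_row_free => u; rewrite mulA -row_mx0 => /eq_row_mx[u1 up].
  have {}u1 : \sum_(v in S) c u v = 0.
    by move/matrixP/(_ 0 0): u1; rewrite !mxE mulr1n.
  apply/rowP => i; rewrite -cE mxE; apply: (indep _ u1 up); exact: enum_valP.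
have [u /esym] := submxP (submx_full (row_mx 1%:M y) fullA).
rewrite mulA => /eq_row_mx[/matrixP/(_ 0 0)]; rewrite !mxE !mulr1n => c1 cp.
by exists (c u).
Qed.

End LinearStresses.

(** * Combinatorics of adjacent facets *)

Lemma subset_of_card (T : finType) (A : {set T}) k : (k <= #|A|)%N ->
  exists2 G : {set T}, G \subset A & #|G| = k.
Proof.
case/card_geqP => s [us <- sA]; exists [set x in s].
  by apply/subsetP => x; rewrite inE; apply: sA.
by rewrite cardsE; apply/card_uniqP.
Qed.

Section Adjacency.

Variables (n d : nat) (Delta : {set {set 'I_n}}).
Hypotheses (hd : (3 <= d)%N) (cplx : simplicial_complex Delta).
Hypothesis pureD : pure Delta (d%:Z - 1).
Implicit Types (F G s : {set 'I_n}).

Lemma facet_cover s : s \in Delta -> exists2 F, facet Delta F & s \subset F.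
Proof. by move=> /(@maxset_exists _ (fun s => s \in Delta))[F]; exists F. Qed.

Lemma facet_subset F s : facet Delta F -> s \subset F -> s \in Delta.
Proof. by move=> /maxsetp FD; apply: cplx.2. Qed.

Lemma card_facet F : facet Delta F -> #|F| = d.
Proof. by move=> /pureD /addIr[]. Qed.

(** The shared face bounds the intersection below by [d - 1], distinctness bounds the union below by
    [d + 1], and the two sizes add up to [2d]. *)
Lemma card_adjacent F F' : adjacent Delta (d%:Z - 1) F F' ->
  #|F :|: F'| = d.+1 /\ #|F :&: F'| = d.-1.
Proof.
case/and4P => fF fF' neq /existsP[s /and4P[_ sF sF' /eqP]]; rewrite /face_dim => cs.
have := subset_leq_card (_ : s \subset F :&: F').
rewrite subsetI sF sF' => /(_ isT).
have := cardsUI F F'; rewrite (card_facet fF) (card_facet fF').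
have : (d < #|F :|: F'|)%N.
  rewrite -(card_facet fF); apply: proper_card.
  rewrite properE subsetUl subUset subxx /=.
  apply: contra neq => F'F; rewrite eq_sym eqEcard F'F /=.
  by rewrite (card_facet fF) (card_facet fF').
lia.
Qed.

(** Two subsets of size [d - 1] of the [d]-element set [F'] meet in at least [d - 2] elements. *)
Lemma adjacent_adjacent_common_face F F' F'' :
    adjacent Delta (d%:Z - 1) F F' -> adjacent Delta (d%:Z - 1) F' F'' ->
  exists2 G : {set 'I_n}, #|G| = d.-2 & [/\ G \subset F, G \subset F' & G \subset F''].
Proof.
move=> ad ad'; have [_ c1] := card_adjacent ad; have [_ c2] := card_adjacent ad'.
case/and4P: ad => _ fF' _ _.
have [|G GI cG] := @subset_of_card _ ((F :&: F') :&: (F' :&: F'')) d.-2.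
  have := cardsUI (F :&: F') (F' :&: F''); rewrite c1 c2.
  have := subset_leq_card (_ : (F :&: F') :|: (F' :&: F'') \subset F').
  rewrite subUset subsetIr subsetIl (card_facet fF') => /(_ isT); lia.
by exists G => //; move: GI; rewrite !subsetI => /andP[/andP[-> ->] /andP[_ ->]].
Qed.

Lemma star_vertex F G v : facet Delta F -> G \subset F -> v \in F ->
  [set v] \in star Delta G.
Proof.
move=> fF GF vF; rewrite inE.
by apply/andP; split; apply: (facet_subset fF); rewrite ?subUset sub1set ?vF.
Qed.

End Adjacency.

(** These are the coefficients of the dependence that expresses [w] through [A]; [w] itself may lie
    in [A]. The family [f] is left general so that it can be the variables, the points, or the
    constant 1. *)
Lemma sum_delta_sub (R : nzRingType) (V : lmodType R) (I : finType) (A : {pred I})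
    (c : I -> R) (f : I -> V) w :
  \sum_v ((v == w)%:R - (if v \in A then c v else 0)) *: f v =
  f w - \sum_(v in A) c v *: f v.
Proof.
under eq_bigr do rewrite scalerBl.
rewrite sumrB (bigD1 w) //= eqxx scale1r big1 ?addr0 => [|v /negbTE->]; last first.
  by rewrite scale0r.
congr (_ - _); rewrite [RHS]big_mkcond; apply: eq_bigr => v _.
by case: ifP => // _; rewrite scale0r.
Qed.

(** * Propagation along paths of facets *)

Section Spanning.

Variables (R : realType) (n d : nat) (Delta : {set {set 'I_n}}).
Variable p : 'I_n -> 'rV[R]_d.
Hypotheses (hd : (3 <= d)%N) (cplx : simplicial_complex Delta).
Hypothesis pureD : pure Delta (d%:Z - 1).
Hypothesis hp : forall F F', adjacent Delta (d%:Z - 1) F F' ->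
  affinely_independent p (F :|: F').

(** [Q] will be instantiated with the combinations of the variables of a fixed adjacent pair, modulo
    the sum of the stress spaces of the stars. *)
Variable Q : {mpoly R[n]} -> Prop.
Hypothesis subQ : submodule Q.
Hypothesis starQ : forall G q, G \in Delta -> #|G| = d.-2 ->
  q \in affine_stress 1 (star Delta G) p -> Q q.

(* The face [G] common to the three facets has all of [F :|: F'] and [F''] in
   its star, so expressing [p w] in the affine basis [F :|: F'] is a stress
   on that star. *)
Lemma span_adjacent F F' F'' :
    adjacent Delta (d%:Z - 1) F F' -> adjacent Delta (d%:Z - 1) F' F'' ->
    (forall v, v \in F :|: F' -> Q 'X_v) ->
  forall w, w \in F'' -> Q 'X_w.
Proof.
move=> ad ad' QF w wF''.
have [G cG [GF GF' GF'']] := adjacent_adjacent_common_face hd pureD ad ad'.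
have [cU _] := card_adjacent hd pureD ad.
have [c c1 cp] := affine_coordinates (p w) (hp ad) cU.
rewrite -['X_w](subrK (\sum_(v in F :|: F') c v *: 'X_v)).
apply: (submoduleD subQ); last exact: submodule_sum.
case/and4P: ad => fF fF' _ _; case/and4P: ad' => _ fF'' _ _.
apply: (starQ (facet_subset cplx fF GF) cG); apply/affine_stress1P.
eexists; last by rewrite -sum_delta_sub.
split; last by rewrite sum_delta_sub cp subrr.
  move=> v vG; case: (v =P w) => [e|_].
    by rewrite e (star_vertex cplx fF'') in vG.
  case: ifP => [vU|_]; last by rewrite subrr.
  case/negP: vG; rewrite inE in vU.
  by case/orP: vU => [/(star_vertex cplx fF GF)|/(star_vertex cplx fF' GF')].
have := sum_delta_sub (V := R^o) (mem (F :|: F')) c (fun=> 1) w.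
under eq_bigr do rewrite [_ *: _]mulr1.
move=> ->; under eq_bigr do rewrite [_ *: _]mulr1.
by rewrite c1 subrr.
Qed.

(** The induction slides a window of two consecutive facets along the path; the invariant is that
    [Q] holds on the variables of their union. *)
Lemma span_path F F' s :
    adjacent Delta (d%:Z - 1) F F' -> path (adjacent Delta (d%:Z - 1)) F' s ->
    (forall v, v \in F :|: F' -> Q 'X_v) ->
  forall w, w \in last F' s -> Q 'X_w.
Proof.
elim: s F F' => [|F'' s IH] F F' ad /=.
  by move=> _ QF w wF'; apply: QF; rewrite inE wF' orbT.
case/andP => ad' pth QF; apply: (IH F' F'') => // v.
rewrite inE => /orP[vF'|]; first by apply: QF; rewrite inE vF' orbT.
exact: span_adjacent ad ad' QF v.
Qed.

End Spanning.

(** * The two decompositions *)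

Lemma affine_stress1_in_sum_stars (R : realType) (n d : nat)
    (Delta : {set {set 'I_n}}) (p : 'I_n -> 'rV[R]_d) (q : {mpoly R[n]}) :
    (3 <= d)%N -> simplicial_complex Delta ->
    strongly_connected Delta (d%:Z - 1) ->
    (forall F F', adjacent Delta (d%:Z - 1) F F' ->
      affinely_independent p (F :|: F')) ->
    q \in affine_stress 1 Delta p ->
  in_sum (fun G => (G \in Delta) && (face_dim G == d%:Z - 3))
    (fun G => affine_stress 1 (star Delta G) p) q.
Proof.
move=> hd cplx [pureD conn] hp qD.
set P := fun G => _; set S := fun G => _.
have subS G : P G -> submodule (fun x => x \in S G).
  by move=> _; apply: submodule_affine_stress1.
have dimG (G : {set 'I_n}) : #|G| = d.-2 -> face_dim G == d%:Z - 3.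
  by rewrite /face_dim => ->; apply/eqP; lia.
have [F fF _] := facet_cover cplx.1.
have [[F' ad]|isolated] : (exists F', adjacent Delta (d%:Z - 1) F F') \/
    (forall F', ~~ adjacent Delta (d%:Z - 1) F F').
- case: (pickP (adjacent Delta (d%:Z - 1) F)) => [F' ad|noad]; first by left; exists F'.
  by right=> F'; rewrite noad.
- have Qsub := submodule_mod_span (mem (F :|: F')) (fun v => 'X_v) (submodule_in_sum subS).
  set Q := (fun x => _) in Qsub.
  have QS x : in_sum P S x -> Q x.
    move=> Sx; exists (fun=> 0); rewrite big1 ?subr0 // => i _.
    exact: scale0r.
  have fF' : facet Delta F' by case/and4P: ad.
  have QF v : v \in F :|: F' -> Q 'X_v.
    move=> vF; exists (fun u => (u == v)%:R).
    rewrite (bigD1 v) //= eqxx scale1r big1 ?addr0 ?subrr.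
      by case: (submodule_in_sum subS).
    by move=> u /andP[_ /negbTE->]; rewrite scale0r.
  have QX v : v \in vertices Delta -> Q 'X_v.
    rewrite inE => /facet_cover[F'' fF'']; rewrite sub1set => vF''.
    (* The path starts at [F'], so that [F] and [F'] form its first window. *)
    have /connectP[s pth e] := conn _ _ fF' fF''.
    apply: (span_path hd cplx pureD hp Qsub _ ad pth QF); last by rewrite -e.
    move=> G x GD cG xG; apply: QS; apply: (in_sum_mem subS (i := G)) => //.
    by rewrite /P GD dimG.
  have [b Sb] : Q q.
    have /affine_stress1P[a [a0 _ _] ->] := qD.
    rewrite (bigID (mem (vertices Delta))) /= [X in _ + X]big1 ?addr0.
      exact: submodule_sum.
    by move=> v; rewrite inE => /a0->; rewrite scale0r.
  suff b0 : \sum_(v in F :|: F') b v *: 'X_v = 0 :> {mpoly R[n]}.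
    by rewrite b0 subr0 in Sb.
  (* The remainder differs from [q] by a sum of stresses on stars, each a stress on [Delta], so it
     is a stress on [Delta] too. Its coefficients are then an affine dependence of the points of
     [F :|: F'], hence zero. *)
  have bD : \sum_(v in F :|: F') b v *: 'X_v \in affine_stress 1 Delta p.
    have subD := @submodule_affine_stress1 R n d Delta p.
    have rD : q - \sum_(v in F :|: F') b v *: 'X_v \in affine_stress 1 Delta p.
      apply: (in_sum_sub subD) Sb => G x _; apply: affine_stress1_sub => v.
      by rewrite inE => /andP[].
    by have := subD.2 (-1) _ _ rD qD; rewrite scaleN1r opprB subrK.
  have /affine_stress1P[a [_ a1 ap] e] := bD.
  have aE v : a v = if v \in F :|: F' then b v else 0.
    rewrite -mcoeff_linear_form -e big_mkcond /=.
    rewrite -[RHS](mcoeff_linear_form (fun v => if v \in F :|: F' then b v else 0)).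
    by congr _@__; apply: eq_bigr => u _; case: ifP; rewrite ?scale0r.
  rewrite big1 // => v vF; rewrite (hp _ _ ad b _ _ v vF) ?scale0r //.
    by rewrite -[RHS]a1 big_mkcond; apply: eq_bigr => u _; rewrite aE.
  rewrite -[RHS]ap big_mkcond /=; apply: eq_bigr => u _.
  by rewrite aE; case: ifP; rewrite ?scale0r.
(* A nonempty path from [F] would begin with a facet adjacent to [F], so [F] is the only facet. *)
have all_sub_F s : s \in Delta -> s \subset F.
  move=> /facet_cover[F' fF' sF'].
  have /connectP[[|F'' t] /= pth e] := conn _ _ fF fF'.
    by rewrite -e.
  by case/andP: pth => ad; rewrite (negbTE (isolated _)) in ad.
have [|G GF cG] := @subset_of_card _ F d.-2; first by rewrite (card_facet pureD) //; lia.
apply: (in_sum_mem subS (i := G)).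
  by rewrite /P dimG // (facet_subset cplx fF GF).
apply: affine_stress1_sub qD => v /all_sub_F; rewrite sub1set.
exact: star_vertex.
Qed.

Theorem theorem4p1 (R : realType) (n d : nat) (Delta : {set {set 'I_n}})
    (p : 'I_n -> 'rV[R]_d) (hd : (3 <= d)%N)
    (hDelta : simplicial_complex Delta)
    (hconn : strongly_connected Delta (d%:Z - 1))
    (hp : forall F F' : {set 'I_n}, adjacent Delta (d%:Z - 1) F F' ->
       affinely_independent p (F :|: F')) :
  (forall q : {mpoly R[n]},
     q \in affine_stress 1 Delta p <->
     in_sum (fun G : {set 'I_n} => (G \in Delta) && (face_dim G == d%:Z - 3))
       (fun G => affine_stress 1 (star Delta G) p) q) /\
  (forall q : {mpoly R[n]},
     q \in affine_stress 1 Delta p <->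
     in_sum (fun v : 'I_n => v \in vertices Delta)
       (fun v => affine_stress 1 (star Delta [set v]) p) q).
Proof.
have subD := @submodule_affine_stress1 R n d Delta p.
have star_sub G q : q \in affine_stress 1 (star Delta G) p ->
    q \in affine_stress 1 Delta p.
  by apply: affine_stress1_sub => v; rewrite inE => /andP[].
split=> q; split.
- exact: affine_stress1_in_sum_stars.
- by apply: (in_sum_sub subD) => G x _; apply: star_sub.
- have subS v : v \in vertices Delta ->
      submodule (fun x => x \in affine_stress 1 (star Delta [set v]) p).
    by move=> _; apply: submodule_affine_stress1.
  move/(affine_stress1_in_sum_stars hd hDelta hconn hp).
  apply: (in_sum_sub (submodule_in_sum subS)) => G x /andP[GD dimG] xG.
  (* As [d >= 3], the face [G] has [d - 2 > 0] elements; for any [v] in it, the star of [G] lies in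
     the star of [v]. *)
  have [v vG] : exists v, v \in G.
    by apply/set0Pn; rewrite -card_gt0; move: dimG; rewrite /face_dim; lia.
  apply: (in_sum_mem subS (i := v)).
    by rewrite inE; apply: hDelta.2 GD _; rewrite sub1set.
  apply: affine_stress1_sub xG => u; rewrite !inE => /andP[-> uG] /=.
  by apply: hDelta.2 uG _; rewrite setUS // sub1set.
- by apply: (in_sum_sub subD) => v x _; apply: star_sub.
Qed.
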